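(* Let $\mathcal{M}=(X,U,\Pr,c)$ be a transient, total cost MDP with $|X|=n$, transient set $X^T$, absorbing state $x_M$ and initial distribution $\beta$ with $\beta(x_M)=0$, satisfying the positivity assumption and the reachability assumption. Let $\tau\in(0,1)$ and $d\in\mathbb{N}$. Let $\Pi$ be the set of all (history-dependent, randomized) policies, let $c(\omega)$ be the total cost, let $c^{[d]}(\omega)$ be the total cost of the surrogate problem with timeout $d$, let $\overline{K}$ be the maximal one-step cost, and let $\gamma>0$ be the minimal simple-path probability to $x_M$. Then $$\min_{\pi\in\Pi}\mathrm{AVaR}_{\tau}(c^{[d]}(\omega))\;\le\;\min_{\pi\in\Pi}\mathrm{AVaR}_{\tau}(c(\omega))\;\le\;\min_{\pi\in\Pi}\mathrm{AVaR}_{\tau}(c^{[d]}(\omega))+\frac{n\overline{K}}{1-\tau}\,\frac{(1-\gamma)^{\lfloor (d+1)/n\rfloor}}{\gamma}.$$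
   Context: MDP. A finite MDP is $\mathcal{M}=(X,U,\Pr,c)$: $X=\{x_1,\dots,x_n\}$ is a finite state space with $n$ elements; $U=\{U(x_i)\}_{i=1}^n$ where $U(x)$ is the finite (nonempty) set of actions available at $x$; $\Pr(y|x,u)$ is the probability of moving from $x$ to $y$ under $u\in U(x)$; $c(x,u)\ge 0$ is the cost of using $u\in U(x)$ at $x$. Policies. The admissible histories up to time $t$ are sequences $x_0,u_0,x_1,\dots,x_{t-1},u_{t-1},x_t$ with $u_i\in U(x_i)$. A policy $\pi\in\Pi$ assigns to every history (for every $t$) a probability distribution on $U(x_t)$; $\Pi$ is the set of all such policies (history-dependent and randomized). A policy $\pi$ and initial distribution $\beta$ on $X$ induce a probability measure $\Pr_\beta^\pi$ on the set of trajectories $\omega=(x_0,u_0,x_1,u_1,\dots)$; $x_t(\omega),u_t(\omega)$ denote the state and action at time $t$. Expectations, VaR and AVaR are taken with respect to $\Pr_\beta^\pi$. Transient, total cost MDP. $X=X^T\cup\{x_M\}$ (disjoint), where $x_M$ is a single absorbing state with a single action $u_{x_M}$, $\Pr(x_M|x_M,u_{x_M})=1$ and $c(x_M,u_{x_M})=0$; for each policy $\pi$, $\sum_{t=0}^\infty \Pr_\beta^\pi[x_t=x]<\infty$ for all $x\in X^T$. The total cost is $c(\omega)=\sum_{t=0}^\infty c(x_t(\omega),u_t(\omega))$. It is assumed that $\beta(x_M)=0$. Let $\mathcal{K}=\{(x,u): x\in X^T, u\in U(x)\}$ and $\overline{K}=\max_{(x,u)\in\mathcal{K}}c(x,u)$.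 Positivity assumption. $\underline{K}:=\min_{(x,u)\in\mathcal{K}}c(x,u)>0$. Reachability assumption. For a selection of inputs $u_1\in U(x_1),\dots,u_n\in U(x_n)$, let $\mathcal{MC}_{u_1,\dots,u_n}$ be the Markov chain on $X$ with transition probabilities $\Pr_{i,j}=\Pr(x_j|x_i,u_i)$. For every such selection, $x_M$ is reachable in $\mathcal{MC}_{u_1,\dots,u_n}$ from every $x\in X^T$ (i.e. it is reached with positive probability after some number $k\ge1$ of transitions). Constant $\gamma$. For a selection of inputs and $x\in X^T$, let $p_x(u_1,\dots,u_n)$ be the smallest strictly positive probability of a simple (cycle-free) path from $x$ to $x_M$ in $\mathcal{MC}_{u_1,\dots,u_n}$, the probability of a path being the product of its transition probabilities. Then $\gamma:=\min_{u_1\in U(x_1),\dots,u_n\in U(x_n)}\ \min_{x\in X^T}p_x(u_1,\dots,u_n)$. Surrogate problem. Given $d\in\mathbb{N}$, the surrogate process coincides with the original process up to time $d$ and then moves surely to $x_M$ at time $d+1$ (if not already there), remaining there with zero cost. $c^{[d]}(\omega)$ denotes the total cost accrued by the surrogate process along $\omega$. Risk. For a random variable $Y$ and $\tau\in(0,1)$, $\mathrm{VaR}_\tau(Y)=\inf\{\eta\in\mathbb{R}:\Pr(Y\le\eta)\ge\tau\}$ and $\mathrm{AVaR}_\tau(Y)=\frac{1}{1-\tau}\int_\tau^1\mathrm{VaR}_t(Y)\,dt$; equivalently $\mathrm{AVaR}_\tau(Y)=\min_{s\in\mathbb{R}}\{s+\frac{1}{1-\tau}\mathbb{E}[(Y-s)^+]\}$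 with $x^+=\max(x,0)$. *)

(* Defs.v *)
From HB Require Import structures.
From mathcomp Require Import all_boot all_order all_algebra.
From mathcomp Require Import all_classical all_reals all_analysis.
Set Implicit Arguments.
Unset Strict Implicit.
Unset Printing Implicit Defensive.
Import Order.TTheory GRing.Theory Num.Theory.
Import numFieldNormedType.Exports.
Local Open Scope classical_set_scope.
Local Open Scope ring_scope.

Record fdist (R : realType) (T : finType) := FDist {
  fdist_fun :> T -> R;
  fdist_ge0 : forall a, 0 <= fdist_fun a;
  fdist_sum1 : \sum_a fdist_fun a = 1 }.

Record mdp (R : realType) := MDP {
  state : finType;
  act : state -> finType;
  trans : forall x : state, act x -> fdist R state;
  cost : forall x : state, act x -> R;
  state_gt0 : (0 < #|state|)%N;
  act_gt0 : forall x, (0 < #|act x|)%N;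
  cost_ge0 : forall (x : state) (u : act x), 0 <= cost u }.

Section Trajectories.
Context (R : realType) (M : mdp R).

(* [Tagged act u] is the pair (x, u) with u in U(x). *)
Definition state_action := {x : state M & act x}.

Definition some_state_action : state_action :=
  Tagged (@act R M) (enum_val (Ordinal (act_gt0 (enum_val (Ordinal (state_gt0 M)))))).

(* The library's measurable types are pointed. *)
HB.instance Definition _ := Finite.copy state_action {x : state M & act x}.
HB.instance Definition _ := isPointed.Build state_action some_state_action.

Definition traj := nat -> state_action.

Definition cylinder (w : seq state_action) : set traj :=
  [set omega | mkseq omega (size w) = w].

Definition cylinders : set (set traj) := range cylinder.

Definition traj_space := g_sigma_algebraType cylinders.

Definition state_at (omega : traj) (t : nat) : state M := tag (omega t).

Definition cost_at (omega : traj) (t : nat) : R := cost (tagged (omega t)).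

(* The admissible history x_0, u_0, ..., x_{t-1}, u_{t-1}, x_t is given by the
   sequence h of its first t state-action pairs and its current state x_t. *)
Definition policy := forall (h : seq state_action) (x : state M), fdist R (act x).

Definition next_state (beta : fdist R (state M)) (h : seq state_action) :
    fdist R (state M) :=
  if h is z :: h' then trans (tagged (last z h')) else beta.

Definition step_prob (beta : fdist R (state M)) (pi : policy)
    (h : seq state_action) (z : state_action) : R :=
  next_state beta h (tag z) * pi h (tag z) (tagged z).

End Trajectories.

(* [word_prob q h w]: probability that the history h is continued by w when q h
   is the law of the letter that follows h. *)
Fixpoint word_prob (R : realType) (S : Type) (q : seq S -> S -> R)
    (h w : seq S) : R :=
  if w is s :: w' then q h s * word_prob q (rcons h s) w' else 1.

Section TrajectoryLaw.
Context (R : realType) (M : mdp R).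
Local Notation S := (state_action M).
Let s0 : S := some_state_action M.
Let e : seq S := enum [set: S]%SET.

Section Digits.
Context (q : seq S -> S -> R).
Hypothesis q_ge0 : forall h s, 0 <= q h s.
Hypothesis q_sum1 : forall h, \sum_s q h s = 1.

Let G h k : R := \sum_(0 <= i < k) q h (nth s0 e i).
Let F h s : R := G h (index s e).

Let mem_e s : s \in e.
Proof. by rewrite mem_enum inE. Qed.

Let G_le h j k : (j <= k)%N -> G h j <= G h k.
Proof.
move=> jk; rewrite /G (big_cat_nat (leq0n j) jk) //= lerDl.
exact: sumr_ge0.
Qed.

Let G_size h : G h (size e) = 1.
Proof.
rewrite /G -(big_nth s0 xpredT (q h)) -(q_sum1 h) /e big_enum /=.
by apply: eq_bigl => s; rewrite inE.
Qed.

Let G_index h s : G h (index s e).+1 = F h s + q h s.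
Proof. by rewrite /F /G big_nat_recr //= nth_index. Qed.

Let digit h (a l u : R) : S :=
  nth s0 e (find (fun k => u < a + l * G h k.+1) (iota 0 (size e))).

Let digitP h a l u s : 0 <= l -> a <= u < a + l ->
  (digit h a l u = s) <->
  (a + l * F h s <= u < a + l * F h s + l * q h s).
Proof.
move=> l0 /andP[au ul].
set p := fun k => u < a + l * G h k.+1.
have [N NE] : exists N, size e = N.+1.
  by case E : e (mem_e s0) => [//|z e'] _; exists (size e').
have hp : has p (iota 0 (size e)).
  apply/hasP; exists N; first by rewrite mem_iota NE /=.
  by rewrite /p -NE G_size mulr1.
have jlt : (find p (iota 0 (size e)) < size e)%N.
  by rewrite -{2}(size_iota 0 (size e)) -has_find.
split.
- rewrite /digit -/p => <-; set j := find p _ in jlt *.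
  have jE : index (nth s0 e j) e = j by rewrite index_uniq ?enum_uniq.
  have := nth_find 0%N hp; rewrite -/j nth_iota // add0n /p => pj.
  rewrite -addrA -mulrDr -G_index /F jE pj andbT.
  case jj : j => [|k]; first by rewrite /G big_geq // mulr0 addr0.
  have kj : (k < j)%N by rewrite jj.
  have := before_find 0%N kj.
  rewrite nth_iota ?(ltn_trans kj) // add0n /p => /negbT.
  by rewrite -leNgt.
- rewrite -addrA -mulrDr -G_index => /andP[su us].
  rewrite /digit -/p; set j := find p _ in jlt *.
  suff -> : j = index s e by rewrite nth_index.
  apply/eqP; rewrite eqn_leq; apply/andP; split.
  + rewrite leqNgt; apply/negP => ij.
    have := before_find 0%N ij.
    by rewrite nth_iota ?index_mem // add0n /p us.
  + rewrite leqNgt; apply/negP => ij.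
    have := nth_find 0%N hp; rewrite -/j nth_iota // add0n /p => pj.
    have le1 : a + l * G h j.+1 <= a + l * F h s.
      by rewrite lerD2l ler_wpM2l // G_le.
    by have := lt_le_trans pj (le_trans le1 su); rewrite ltxx.
Qed.

Let digits_from h a l u n : S :=
  (fix D h a l n {struct n} :=
    let s := digit h a l u in
    if n is n'.+1 then D (rcons h s) (a + l * F h s) (l * q h s) n' else s)
  h a l n.

Fixpoint left_end h (a l : R) (w : seq S) : R :=
  if w is s :: w' then left_end (rcons h s) (a + l * F h s) (l * q h s) w'
  else a.

Let word_prob_ge0 h w : 0 <= word_prob q h w.
Proof. by elim: w h => [|s w IH] h //=; rewrite mulr_ge0. Qed.

Let F_ge0 h s : 0 <= F h s.
Proof. exact: sumr_ge0. Qed.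

Let F_le1 h s : F h s + q h s <= 1.
Proof. by rewrite -G_index -(G_size h) G_le // index_mem. Qed.

Let left_end_sub h a l w : 0 <= l ->
  a <= left_end h a l w /\ left_end h a l w + l * word_prob q h w <= a + l.
Proof.
elim: w h a l => [|s w IH] h a l l0 /=; first by rewrite mulr1.
have [|h1 h2] := IH (rcons h s) (a + l * F h s) (l * q h s).
  by rewrite mulr_ge0.
split; first by apply: le_trans h1; rewrite lerDl mulr_ge0.
rewrite mulrA (le_trans h2) // -addrA -mulrDr lerD2l.
by rewrite -[leRHS]mulr1 ler_wpM2l.
Qed.

Let digitsP h a l u w : 0 <= l -> a <= u < a + l ->
  (mkseq (digits_from h a l u) (size w) = w) <->
  (left_end h a l w <= u < left_end h a l w + l * word_prob q h w).
Proof.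
elim: w h a l => [|s w IH] h a l l0 ual; first by rewrite /= mulr1.
have lq0 : 0 <= l * q h s by rewrite mulr_ge0.
have eqS : mkseq (digits_from h a l u) (size w).+1 =
    digit h a l u :: mkseq (digits_from (rcons h (digit h a l u))
      (a + l * F h (digit h a l u)) (l * q h (digit h a l u)) u) (size w).
  rewrite /mkseq /=; congr (_ :: _).
  by rewrite -[in LHS](addn0 1%N) iotaDl -map_comp.
rewrite [size _]/= eqS; split.
- move=> [ds]; rewrite ds => ws.
  have us := (digitP h s l0 ual).1 ds.
  by rewrite /= mulrA; apply: (IH _ _ _ lq0 us).1.
- rewrite /= mulrA => uw.
  have [h1 h2] := left_end_sub (rcons h s) (a + l * F h s) w lq0.
  have us : a + l * F h s <= u < a + l * F h s + l * q h s.
    case/andP: uw => u1 u2.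
    by rewrite (le_trans h1 u1) (lt_le_trans u2 h2).
  rewrite ((digitP h s l0 ual).2 us); congr (_ :: _).
  exact: (IH _ _ _ lq0 us).2.
Qed.

Let digits (u : R) : traj_space M :=
  if u \in `[0, 1[ then digits_from [::] 0 1 u else fun=> s0.

Let unit_itv : set R := `[0, 1[.

Let digits_cylinder w : unit_itv `&` digits @^-1` cylinder w =
  [set` `[left_end [::] 0 1 w, left_end [::] 0 1 w + word_prob q [::] w[].
Proof.
have [h1 h2] := left_end_sub [::] 0 w (@ler01 R).
rewrite mul1r add0r in h2.
apply/seteqP; split => u /=.
- rewrite /unit_itv /= /digits => -[u01]; rewrite u01.
  have u01' : 0 <= u < 0 + 1 by rewrite add0r; move: u01; rewrite in_itv.
  rewrite /cylinder /= => /(digitsP [::] w ler01 u01').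
  by rewrite mul1r in_itv.
- rewrite in_itv /= => uw.
  have u01 : u \in `[0, 1[.
    case/andP: uw => u1 u2.
    by rewrite in_itv /= (le_trans h1 u1) (lt_le_trans u2 h2).
  split; first exact: u01.
  rewrite /cylinder /digits u01 /=.
  have u01' : 0 <= u < 0 + 1 by rewrite add0r; move: u01; rewrite in_itv.
  by apply/(digitsP [::] w ler01 u01'); rewrite mul1r.
Qed.

Let measurable_digits : measurable_fun [set: R] digits.
Proof.
apply: (@measurability _ _ _ (traj_space M) _ _ (@cylinders R M)) => //.
move=> _ [_ [w _ <-] <-]; rewrite setTI.
rewrite -(setIT (_ @^-1` _)) -(setUv unit_itv) setIUr.
apply: measurableU.
  by rewrite setIC digits_cylinder; exact: measurable_itv.
have [c|c] := pselect (cylinder w (fun=> s0)).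
  rewrite (_ : _ `&` _ = ~` unit_itv); first by apply: measurableC; exact: measurable_itv.
  apply/seteqP; split => u /=; first by case.
  move=> u01; split=> //; rewrite /digits.
  by case: ifPn => // /u01.
rewrite (_ : _ `&` _ = set0) //.
apply/seteqP; split => u //=; rewrite /unit_itv/digits/=.
by case: ifPn => // _ [].
Qed.

(* The law of the letters read off a uniform point of [0, 1[ by successively
   subdividing intervals in proportion to q. *)
Lemma word_law_exists :
  exists P : probability (traj_space M) R,
    forall w, P (cylinder w) = (word_prob q [::] w)%:E.
Proof.
have munit : measurable unit_itv by exact: measurable_itv.
pose mu := mrestr (@lebesgue_measure R) munit.
pose P0 := pushforward mu digits.
have P0E w : P0 (cylinder w) = (word_prob q [::] w)%:E.
  rewrite /P0 /pushforward /mu /mrestr setIC digits_cylinder.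
  rewrite lebesgue_measure_itv /= lte_fin ltrDl.
  case: ltP => [_|wle]; first by rewrite -EFinD addrAC subrr add0r.
  by congr (_%:E); apply/le_anti; rewrite wle word_prob_ge0.
pose P1 : {measure set (traj_space M) -> \bar R} :=
  measure_function_pushforward__canonical__measure_function_Measure
    (mrestr (@lebesgue_measure R) munit) measurable_digits.
have P1T : P1 [set: traj_space M] = 1%E.
  rewrite (_ : setT = cylinder [::]) ?[LHS]P0E //.
  by apply/seteqP; split.
pose mP := Measure_isProbability.Build _ _ _ P1 P1T.
pose P : probability (traj_space M) R := HB.pack (P1 : set _ -> _) P1 mP.
by exists P; exact: P0E.
Qed.

End Digits.

Context (beta : fdist R (state M)).

Lemma step_prob_ge0 (pi : policy M) h z : 0 <= step_prob beta pi h z.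
Proof. by rewrite mulr_ge0 // fdist_ge0. Qed.

Lemma step_prob_sum1 (pi : policy M) h : \sum_z step_prob beta pi h z = 1.
Proof.
transitivity (\sum_x \sum_(u : act x) next_state beta h x * pi h x u).
  by rewrite sig_big_dep.
rewrite -[RHS](fdist_sum1 (next_state beta h)); apply: eq_bigr => x _.
by rewrite -mulr_sumr fdist_sum1 mulr1.
Qed.

Lemma traj_law_exists (pi : policy M) :
  exists P : probability (traj_space M) R,
    forall w, P (cylinder w) = (word_prob (step_prob beta pi) [::] w)%:E.
Proof.
exact: (word_law_exists (step_prob_ge0 pi) (step_prob_sum1 pi)).
Qed.

(* Cylinders being stable under intersection up to the empty set, a probability
   on the trajectories is determined by its values on them. *)
Definition traj_prob (pi : policy M) : probability (traj_space M) R :=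
  sval (cid (traj_law_exists pi)).

Lemma traj_prob_cylinder (pi : policy M) w :
  traj_prob pi (cylinder w) = (word_prob (step_prob beta pi) [::] w)%:E.
Proof. exact: (svalP (cid (traj_law_exists pi))). Qed.

End TrajectoryLaw.

Section Risk.
Context d (T : measurableType d) (R : realType) (P : probability T R).
Local Open Scope ereal_scope.

Definition VaR (Y : T -> \bar R) (t : R) : \bar R :=
  ereal_inf [set eta%:E | eta in [set eta : R |
    t%:E <= P [set omega | Y omega <= eta%:E]]].

(* VaR at level 1 may be infinite; removing that endpoint does not change the
   integral. *)
Definition AVaR (Y : T -> \bar R) (tau : R) : \bar R :=
  ((1 - tau)^-1)%:E * \int[lebesgue_measure]_(t in `]tau, 1%R[) VaR Y t.

End Risk.

Section TotalCost.
Context (R : realType) (M : mdp R) (xM : state M) (uM : act xM).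

Definition total_cost (omega : traj M) : \bar R :=
  (\sum_(0 <= t <oo) (cost_at omega t)%:E)%E.

Record transient_total_cost (beta : fdist R (state M)) : Prop := {
  absorbing_act : forall u : act xM, u = uM;
  absorbing_trans : trans uM xM = 1;
  absorbing_cost : cost uM = 0;
  transient : forall (pi : policy M) (x : state M), x != xM ->
    (\sum_(0 <= t <oo)
       traj_prob beta pi [set omega | state_at omega t = x] < +oo)%E }.

(* The cost of the action taken at time d is still paid. *)
Definition surrogate (d : nat) (omega : traj M) : traj M :=
  fun t => if (t <= d)%N then omega t else Tagged (@act R M) uM.

Definition surrogate_cost (d : nat) (omega : traj M) : \bar R :=
  total_cost (surrogate d omega).

Definition Kmax : R :=
  \big[Order.max/0]_(z : state_action M | tag z != xM) cost (tagged z).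

(* The default value Kmax is irrelevant when there is a transient state. *)
Definition Kmin : R :=
  \big[Order.min/Kmax]_(z : state_action M | tag z != xM) cost (tagged z).

Definition selection := {dffun forall x : state M, act x}.

Definition chain (f : selection) (x y : state M) : R := trans (f x) y.

Fixpoint chain_iter (f : selection) (k : nat) (x y : state M) : R :=
  if k is k'.+1 then \sum_z chain f x z * chain_iter f k' z y
  else (x == y)%:R.

Definition reachability : Prop :=
  forall (f : selection) (x : state M), x != xM ->
    exists k, (0 < k)%N /\ 0 < chain_iter f k x xM.

(* The path x :: p is given by its source x and its remaining vertices p. *)
Fixpoint path_prob (f : selection) (x : state M) (p : seq (state M)) : R :=
  if p is y :: p' then chain f x y * path_prob f y p' else 1.

Definition simple_path_to_xM (x : state M) (p : seq (state M)) : bool :=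
  uniq (x :: p) && (last x p == xM).

(* A simple path has at most #|X| vertices.  The default value 1 bounds every
   path probability from above, and under [reachability] the set of paths is
   never empty. *)
Definition min_path_prob (f : selection) (x : state M) : R :=
  \big[Order.min/1]_(p : #|state M|.-bseq (state M) |
      simple_path_to_xM x p && (0 < path_prob f x p)) path_prob f x p.

Definition gamma : R :=
  \big[Order.min/1]_(f : selection)
    \big[Order.min/1]_(x : state M | x != xM) min_path_prob f x.

End TotalCost.

Definition is_min (R : realType) (I : Type) (F : I -> \bar R) (m : \bar R) : Prop :=
  (exists i, F i = m) /\ (forall i, m <= F i)%E.

(* Main.v *)
Require Import Defs.
From mathcomp Require Import all_boot all_order all_algebra.
From mathcomp Require Import all_classical all_reals all_analysis.
From mathcomp Require Import measurable_realfun ring lra.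
Import Order.TTheory GRing.Theory Num.Theory.
Import numFieldNormedType.Exports.
Set Implicit Arguments.
Unset Strict Implicit.
Unset Printing Implicit Defensive.
Local Open Scope classical_set_scope.
Local Open Scope ring_scope.

(** AVaR_tau(Y) is the minimum over s of s + E(Y - s)^+ / (1 - tau), attained
    at s = VaR_tau(Y), because VaR_t(Y) has the law of Y when t is uniform.
    Hence AVaR_tau(Y + Z) <= AVaR_tau(Y) + E Z / (1 - tau) for Z >= 0, and the
    theorem reduces to a bound on the mean cost after time d that is uniform in
    the policy.

    Under any policy, n steps lead from any state to xM with probability at
    least gamma: growing a set of states from {xM}, one state at a time, one
    obtains a selection f and simple f-paths to xM whose probabilities bound
    from below the probability that an arbitrary policy is absorbed in time.
    The mean cost after time d is then at most
    Kmax * sum_(t > d) (1 - gamma)^(t / n).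

    Both minima exist by compactness: along an ultrafilter, a minimizing
    sequence of policies and its VaRs converge coordinatewise, the expectation
    of a function of finitely many letters converges, and the tail bound is
    uniform in the policy. *)

(** * Average value-at-risk *)

Section LayerCake.
Context d (T : measurableType d) (R : realType).
Variable m : {sigma_finite_measure set T -> \bar R}.
Local Open Scope ereal_scope.

(** Tonelli's theorem for the region [0 <= r < h x] below the graph of [h], sliced once along each
    coordinate. *)
Lemma ge0_layer_cake (h : T -> \bar R) :
  measurable_fun setT h -> (forall x, 0 <= h x) ->
  \int[m]_x h x =
    \int[lebesgue_measure]_(r in `[0%R, +oo[) m [set x | r%:E < h x].
Proof.
move=> mh h0.
pose GR := measurableTypeR R.
pose A : set (T * GR) := [set p | 0%:E <= p.2%:E] `&` [set p | p.2%:E < h p.1].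
have msnd : measurable_fun setT (fun p : T * GR => p.2%:E).
  by apply: (measurableT_comp (f := @EFin R)) => //; exact: measurable_snd.
have mA : measurable A.
  apply: measurableI; rewrite -[X in measurable X]setTI.
    exact: measurable_lee.
  apply: measurable_lte => //.
  exact: (measurableT_comp mh measurable_fst).
transitivity (\int[m]_x \int[lebesgue_measure]_(r in [set: GR]) (\1_A (x, r))%:E).
  apply: eq_integral => x _.
  transitivity (\int[lebesgue_measure]_(r in [set: R])
      (\1_[set r : R | (0 <= r)%R /\ (r%:E < h x)%E] r)%:E).
    (* The slice over [x] is an interval of length [h x], unbounded when [h x] is [+oo]. *)
    have -> : [set r : R | (0 <= r)%R /\ r%:E < h x] =
      [set` Interval (BLeft 0%R) (match h x with v%:E => BLeft v | _ => +oo%O end)].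
      apply/seteqP; split=> r /=; rewrite in_itv /=;
      have := h0 x; case: (h x) => [v||]//= _; rewrite ?ltry ?lte_fin ?andbT //.
      - by move=> [-> ->].
      - by case.
      - by move=> /andP.
    apply/esym; rewrite (integral_indic (R := R) _ measurableT) ?setIT;
      last exact: measurable_itv.
    rewrite [LHS]lebesgue_measure_itv /=.
    have := h0 x; case: (h x) => [v||]//= v0.
      rewrite lte_fin; case: ltP => [_|v0']; first by rewrite oppr0 adde0.
      by congr EFin; apply/le_anti; rewrite v0' -lee_fin v0.
    by rewrite ltry oppr0 addye.
  by apply: eq_integral => r _; rewrite !indicE.
rewrite (fubini_tonelli (m1 := m) (m2 := lebesgue_measure)
  (fun p : T * GR => (\1_A p)%:E)) /=; last 2 first.
- by apply/measurable_EFinP; exact: measurable_indic.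
- by move=> p; rewrite lee_fin.
rewrite [RHS]integral_mkcond; apply: eq_integral => r _.
rewrite patchE mem_setE in_itv /= andbT; case: ifPn => r0.
  transitivity (\int[m]_x (\1_[set x | (r%:E < h x)%E] x)%:E).
    apply: eq_integral => x _; rewrite !indicE; congr ((nat_of_bool _)%:R%:E)%R.
    by apply/idP/idP; rewrite !inE => //= -[].
  rewrite integral_indic ?setIT// -[X in measurable X]setTI.
  exact: measurable_lte.
apply: integral0_eq => x _; rewrite indicE memNset // => -[/=].
by rewrite lee_fin (negbTE r0).
Qed.

End LayerCake.

Section ValueAtRisk.
Context d (T : measurableType d) (R : realType) (P : probability T R).
Variable Y : T -> \bar R.
Hypothesis mY : measurable_fun setT Y.
Local Open Scope ereal_scope.

Let measurable_le_cst y : measurable [set w | Y w <= y].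
Proof. by rewrite -[X in measurable X]setTI; exact: measurable_lee. Qed.

(* VaR and the distribution function form a Galois connection; this is where
   right-continuity of the latter is used. *)
Lemma VaR_le t (y : R) :
  (VaR P Y t <= y%:E) = (t%:E <= P [set w | Y w <= y%:E]).
Proof.
apply/idP/idP => [Vy|ty]; last first.
  by apply: ereal_inf_lbound; exists y.
(* The sets [S n] decrease to the event in the claim, and each has mass at least [t], since some
   admissible [eta] lies below [y + n.+1%:R^-1]. *)
pose S n := [set w | Y w <= (y + n.+1%:R^-1)%:E].
have SE : \bigcap_n S n = [set w | Y w <= y%:E].
  apply/seteqP; split=> w /= Yw; last first.
    by move=> n _; apply: (le_trans Yw); rewrite lee_fin lerDl.
  apply/lee_addgt0Pr => e e0.
  have [n ne] : exists n, (n.+1%:R^-1 < e)%R.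
    have [n _ /(_ n (leqnn n)) /= h] := near_infty_natSinv_lt (PosNum e0).
    by exists n.
  by apply: (le_trans (Yw n I)); rewrite -EFinD lee_fin lerD2l ltW.
rewrite -SE.
have cvS : P \o S @ \oo --> P (\bigcap_n S n).
  apply: nonincreasing_cvg_mu => //.
  - by rewrite ltey_eq fin_num_measure //; exact: measurable_le_cst.
  - by move=> n; exact: measurable_le_cst.
  - by rewrite SE; exact: measurable_le_cst.
  - move=> m n mn; apply/subsetPset => w /= /le_trans; apply.
    by rewrite lee_fin lerD2l lef_pV2 ?posrE // ler_nat.
apply: (cvge_ge _ cvS); apply: nearW => n /=.
have [|_ [eta /= teta <-] etay] :=
  @ereal_inf_lt _ _ (y + n.+1%:R^-1)%:E (le_lt_trans Vy _).
  by rewrite lte_fin ltrDl.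
apply: (le_trans teta); apply: le_measure; rewrite ?inE; try exact: measurable_le_cst.
by move=> w /= /le_trans; apply; exact: ltW.
Qed.

Lemma VaR_gt t (y : R) :
  (y%:E < VaR P Y t) = (P [set w | Y w <= y%:E] < t%:E).
Proof. by rewrite ltNge VaR_le -ltNge. Qed.

Lemma VaR_nondecreasing t t' : (t <= t')%R -> VaR P Y t <= VaR P Y t'.
Proof.
move=> tt'; apply: ereal_inf_le_tmp => _ [eta /= h <-]; exists eta => //=.
by apply: le_trans h; rewrite lee_fin.
Qed.

(** By [VaR_gt], the levels [t] at which VaR exceeds [y] form the open ray to the right of the
    probability of [Y <= y]. *)
Lemma measurable_VaR D : measurable_fun D (VaR P Y).
Proof.
apply: measurable_funTS => mD.
apply: (measurability _ (ErealGenOInfty.measurableE R)) => //.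
move=> _ [_ [y ->] <-]; rewrite setTI.
have -> : VaR P Y @^-1` `]y%:E, +oo[ = [set` `]fine (P [set w | (Y w <= y%:E)%E]), +oo[].
  apply/seteqP; split=> t /=; rewrite !in_itv /= !andbT VaR_gt;
    by rewrite -[X in X < _]fineK ?lte_fin // fin_num_measure.
exact: measurable_itv.
Qed.

Hypothesis Y0 : forall w, 0 <= Y w.

(** For a negative [eta] the event [Y <= eta] is empty, so its probability cannot reach a positive
    [t]. At [t <= 0] the infimum would be [-oo]. *)
Lemma VaR_ge0 t : (0 < t)%R -> 0 <= VaR P Y t.
Proof.
move=> t0; apply: le_ereal_inf_tmp => _ [eta /= h <-]; rewrite lee_fin leNgt.
apply/negP => eta0; move: h; rewrite (_ : [set w | _] = set0) ?measure0.
  by rewrite lee_fin leNgt t0.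
apply/seteqP; split => // w /= /(le_trans (Y0 w)).
by rewrite lee_fin leNgt eta0.
Qed.

Let excess s (v : \bar R) := maxe (v - s%:E) 0.

Let excess_gt s (r : R) (v : \bar R) : (0 <= r)%R ->
  (r%:E < excess s v) = ((r + s)%:E < v).
Proof.
move=> r0; rewrite /excess lt_max EFinD lteBrDr // orbC.
by rewrite lte_fin ltNge r0.
Qed.

Let measurable_excess s d' (T' : measurableType d') (D : set T') f :
  measurable_fun D f -> measurable_fun D (excess s \o f).
Proof.
move=> mf; apply: measurable_maxe => //.
by apply: emeasurable_funB.
Qed.

Let excess_ge0 s v : 0 <= excess s v.
Proof. by rewrite le_max lexx orbT. Qed.

(** The form used here of the fact that VaR at a uniform level has the law of [Y]. In the layer cake
    formula the level set at height [r] is []p, 1[] on the left, where [p] is the probability of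
    [Y <= r + s], and an event of probability [1 - p] on the right. *)
Lemma integral_VaR_excess s :
  \int[lebesgue_measure]_(t in `]0%R, 1%R[) excess s (VaR P Y t) =
  \int[P]_w excess s (Y w).
Proof.
rewrite integral_mkcond ge0_layer_cake; last 2 first.
- apply/(measurable_restrictT _ (measurable_itv _)).
  by apply: measurable_excess; exact: measurable_VaR.
- by move=> t; apply: erestrict_ge0.
rewrite ge0_layer_cake //; last exact: measurable_excess.
apply: eq_integral => r. rewrite mem_setE in_itv /= andbT => r0.
set p := P [set w | Y w <= (r + s)%:E].
have pfin : p \is a fin_num by apply: fin_num_measure; exact: measurable_le_cst.
have p0 : (0 <= fine p)%R by rewrite /p fine_ge0.
have p1 : (fine p <= 1)%R.
  by rewrite -lee_fin fineK // probability_le1 //; exact: measurable_le_cst.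
have -> : [set t | r%:E < ((fun t => excess s (VaR P Y t)) \_ `]0%R, 1%R[) t] =
    `]fine p, 1%R[%classic.
  apply/seteqP; split=> t /=; rewrite in_itv /= patchE mem_setE in_itv /=.
  - case: ifPn => [/andP[_ ->]|_]; last by rewrite lte_fin ltNge r0.
    by rewrite excess_gt // VaR_gt -/p -[X in X < _]fineK // lte_fin andbT.
  - move=> /andP[pt t1]; rewrite t1 (le_lt_trans p0 pt) /=.
    by rewrite excess_gt // VaR_gt -/p -[X in X < _]fineK // lte_fin.
have -> : [set w | r%:E < excess s (Y w)] = ~` [set w | Y w <= (r + s)%:E].
  by apply/seteqP; split=> w /=; rewrite excess_gt // ltNge => /negP.
rewrite [RHS]probability_setC // -/p lebesgue_measure_itv /= lte_fin.
case: ltP => [_|p1']; first by rewrite -[in RHS](fineK pfin).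
have -> : p = 1 by rewrite -[p]fineK //; congr EFin; apply/le_anti; rewrite p1 p1'.
by rewrite subee.
Qed.

Variable tau : R.
Hypothesis tau01 : (0 < tau < 1)%R.

Let tau0 : (0 < tau)%R. Proof. by case/andP: tau01. Qed.
Let tau1 : (0 < 1 - tau)%R. Proof. by rewrite subr_gt0; case/andP: tau01. Qed.

Let tailE : lebesgue_measure `]tau, 1%R[%classic = (1 - tau)%:E :> \bar R.
Proof. by rewrite [LHS]lebesgue_measure_itv /= lte_fin -subr_gt0 tau1. Qed.

Let integral_add_excess s : (0 <= s)%R ->
  \int[lebesgue_measure]_(t in `]tau, 1%R[) (s%:E + excess s (VaR P Y t)) =
  (s * (1 - tau))%:E +
    \int[lebesgue_measure]_(t in `]tau, 1%R[) excess s (VaR P Y t).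
Proof.
move=> s0; rewrite ge0_integralD //.
- by rewrite integral_cst //= tailE -EFinM.
- by apply: measurable_excess; exact: measurable_VaR.
Qed.

(** Integrate [VaR_t <= s + (VaR_t - s)^+] over []tau, 1[], then enlarge the domain of the excess to
    []0, 1[]. With [s >= 0] every integrand is nonnegative. *)
Lemma AVaR_le_excess s : (0 <= s)%R ->
  AVaR P Y tau <= s%:E + ((1 - tau)^-1)%:E * \int[P]_w excess s (Y w).
Proof.
(* The constant [s] is written as its own average over []tau, 1[], so that the factor [(1 - tau)^-1]
   can be taken out. *)
move=> s0; have -> : s%:E = ((1 - tau)^-1)%:E * (s * (1 - tau))%:E :> \bar R.
  by rewrite -EFinM mulrC mulfK // gt_eqF.
rewrite -muleDr ?fin_num_adde_defr //.
apply: lee_wpmul2l; first by rewrite lee_fin invr_ge0 ltW.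
apply: (@le_trans _ _
  (\int[lebesgue_measure]_(t in `]tau, 1%R[) (s%:E + excess s (VaR P Y t)))).
  apply: ge0_le_integral => //.
  - move=> t /=; rewrite in_itv /= => /andP[taut _].
    by rewrite VaR_ge0 // (lt_trans tau0).
  - exact: measurable_VaR.
  - by apply: emeasurable_funD => //; apply: measurable_excess; exact: measurable_VaR.
  - by move=> t _; rewrite /excess addeC -leeBlDr // le_max lexx.
rewrite integral_add_excess // leeD2l // -integral_VaR_excess.
apply: ge0_subset_integral => //.
- by apply: measurable_excess; exact: measurable_VaR.
- by apply: subset_itvr; rewrite bnd_simp ltW.
Qed.

(** Both inequalities behind [AVaR_le_excess] become equalities: [VaR_t >= s] for [t] above [tau],
    and the excess vanishes for [t] up to [tau]. *)
Lemma AVaR_eq_excess s : VaR P Y tau = s%:E ->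
  AVaR P Y tau = s%:E + ((1 - tau)^-1)%:E * \int[P]_w excess s (Y w).
Proof.
move=> sE; have s0 : (0 <= s)%R by rewrite -lee_fin -sE VaR_ge0.
have -> : s%:E = ((1 - tau)^-1)%:E * (s * (1 - tau))%:E :> \bar R.
  by rewrite -EFinM mulrC mulfK // gt_eqF.
rewrite -muleDr ?fin_num_adde_defr //.
congr (_ * _).
transitivity (\int[lebesgue_measure]_(t in `]tau, 1%R[) (s%:E + excess s (VaR P Y t))).
  apply: eq_integral => t; rewrite mem_setE in_itv /= => /andP[taut _].
  have sV : s%:E <= VaR P Y t by rewrite -sE VaR_nondecreasing // ltW.
  by rewrite /excess max_l ?sube_ge0 // addeC subeK.
rewrite integral_add_excess // -integral_VaR_excess; congr (_ + _).
rewrite integral_mkcond [RHS]integral_mkcond; apply: eq_integral => t _.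
rewrite !patchE !mem_setE !in_itv /=.
have [taut|ttau] := ltP tau t; first by rewrite (lt_trans tau0 taut).
case: ifPn => //= _; rewrite /excess max_r // sube_le0 -sE.
exact: VaR_nondecreasing.
Qed.

(** Markov's inequality: [Y] exceeds [B / (1 - tau)] with probability at most [1 - tau]. *)
Lemma VaR_le_mean (B : R) : (0 < B)%R -> \int[P]_w Y w <= B%:E ->
  VaR P Y tau <= (B / (1 - tau))%:E.
Proof.
move=> B0 YB; rewrite VaR_le; set eta := (B / (1 - tau))%R.
have eta0 : (0 < eta)%R by rewrite divr_gt0.
set A := [set w | _]; have mA : measurable A by exact: measurable_le_cst.
have PA : P A = 1 - P (~` A).
  by rewrite -probability_setC ?setCK //; exact: measurableC.
have : eta%:E * P (~` A) <= B%:E.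
  apply: le_trans YB; rewrite -integral_cst; last exact: measurableC.
  apply: (@le_trans _ _ (\int[P]_(w in ~` A) Y w)).
    apply: ge0_le_integral => //; first exact: measurableC.
    - by move=> w _; rewrite lee_fin ltW.
    - exact: measurable_funTS.
    - by move=> w /= /negP; rewrite -ltNge => /ltW.
  by apply: ge0_subset_integral => //; exact: measurableC.
rewrite PA -[P (~` A)]fineK ?fin_num_measure //; last exact: measurableC.
rewrite -EFinM -EFinB !lee_fin => h.
suff : (fine (P (~` A)) <= 1 - tau)%R by lra.
rewrite -(ler_pM2l eta0); apply: (le_trans h).
by rewrite /eta divfK // gt_eqF.
Qed.

(** The interval that contains the minimiser depends on [B] and [tau] but not on [P], so the
    minimisers for a sequence of policies stay in one compact set. *)
Lemma AVaR_attained (B : R) : (0 < B)%R -> \int[P]_w Y w <= B%:E ->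
  exists2 s, (0 <= s <= B / (1 - tau))%R &
    AVaR P Y tau = s%:E + ((1 - tau)^-1)%:E * \int[P]_w maxe (Y w - s%:E) 0.
Proof.
move=> B0 YB; have V0 := VaR_ge0 tau0; have VB := VaR_le_mean B0 YB.
have [s sE] : exists s, VaR P Y tau = s%:E.
  by move: V0 VB; case: VaR => [s||] // _ _; exists s.
exists s; last exact: AVaR_eq_excess.
by rewrite -!lee_fin -sE V0 VB.
Qed.

End ValueAtRisk.

Lemma integral_excessD_le d (T : measurableType d) (R : realType)
    (m : {measure set T -> \bar R}) (Y Z : T -> \bar R) (s : R) :
  measurable_fun setT Y -> measurable_fun setT Z -> (forall w, 0 <= Z w)%E ->
  (\int[m]_w maxe (Y w + Z w - s%:E) 0 <=
   \int[m]_w maxe (Y w - s%:E) 0 + \int[m]_w Z w)%E.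
Proof.
move=> mY mZ Z0.
have mexc f : measurable_fun setT f ->
    measurable_fun setT (fun w : T => maxe (f w - s%:E) 0)%E.
  by move=> mf; apply: measurable_maxe => //; exact: emeasurable_funB.
have exc0 (v : \bar R) : (0 <= maxe v 0)%E by rewrite le_max lexx orbT.
rewrite -ge0_integralD //; last exact: mexc.
apply: ge0_le_integral => //.
- by apply: mexc; exact: emeasurable_funD.
- by apply: emeasurable_funD => //; exact: mexc.
move=> w _; rewrite ge_max; apply/andP; split; last by rewrite adde_ge0.
by rewrite addeAC leeD2r // le_max lexx.
Qed.

(** The minimiser for [Y] serves as a trial value for [Y + Z]. *)
Lemma AVaRD_le d (T : measurableType d) (R : realType) (P : probability T R)
    (Y Z : T -> \bar R) (tau B : R) :
  measurable_fun setT Y -> measurable_fun setT Z ->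
  (forall w, 0 <= Y w)%E -> (forall w, 0 <= Z w)%E -> 0 < tau < 1 -> 0 < B ->
  (\int[P]_w Y w <= B%:E)%E ->
  (AVaR P (fun w => Y w + Z w) tau <=
   AVaR P Y tau + ((1 - tau)^-1)%:E * \int[P]_w Z w)%E.
Proof.
move=> mY mZ Y0 Z0 tau01 B0 YB.
have [s /andP[s0 _] ->] := AVaR_attained mY Y0 tau01 B0 YB.
have tau1 : (0 <= ((1 - tau)^-1)%:E :> \bar R)%E.
  by rewrite lee_fin invr_ge0 subr_ge0 ltW //; case/andP: tau01.
apply: (@le_trans _ _ (s%:E + ((1 - tau)^-1)%:E *
    \int[P]_w maxe (Y w + Z w - s%:E) 0)%E).
  apply: AVaR_le_excess => //; first exact: emeasurable_funD.
  by move=> w; rewrite adde_ge0.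
rewrite -addeA leeD2l // -ge0_muleDr; last 2 first.
- by apply: integral_ge0 => w _; rewrite le_max lexx orbT.
- exact: integral_ge0.
by rewrite lee_wpmul2l // integral_excessD_le.
Qed.

(** Since [Y' <= eta] implies [Y <= eta], every real admissible in the infimum for [Y'] is
    admissible in that for [Y]. *)
Lemma le_AVaR d (T : measurableType d) (R : realType) (P : probability T R)
    (Y Y' : T -> \bar R) (tau : R) :
  measurable_fun setT Y -> measurable_fun setT Y' ->
  (forall w, 0 <= Y w)%E -> (forall w, Y w <= Y' w)%E -> 0 < tau < 1 ->
  (AVaR P Y tau <= AVaR P Y' tau)%E.
Proof.
move=> mY mY' Y0 YY' /andP[tau0 tau1].
apply: lee_wpmul2l; first by rewrite lee_fin invr_ge0 subr_ge0 ltW.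
apply: ge0_le_integral => //.
- move=> t /=; rewrite in_itv /= => /andP[taut _].
  by rewrite VaR_ge0 // (lt_trans tau0).
- exact: measurable_VaR.
- exact: measurable_VaR.
- move=> t _; apply: ereal_inf_le_tmp => _ [eta /= h <-]; exists eta => //=.
  apply: (le_trans h); apply: le_measure; rewrite ?inE.
  + by rewrite -[X in measurable X]setTI; exact: measurable_lee.
  + by rewrite -[X in measurable X]setTI; exact: measurable_lee.
  + by move=> w /=; apply: le_trans.
Qed.

(** * Expectations over finite words *)

Section Expect.
Context (R : realType) (S : finType).
Implicit Types (q : seq S -> S -> R) (phi psi : seq S -> R) (h : seq S).

(* Mean of phi over the words obtained from h by adding k letters. *)
Fixpoint expect q k h phi : R :=
  if k is k'.+1 then \sum_s q h s * expect q k' (rcons h s) phi else phi h.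

Lemma expectD q j k h phi :
  expect q (j + k) h phi = expect q j h (fun h' => expect q k h' phi).
Proof.
by elim: j h => [|j IH] h //=; apply: eq_bigr => s _; rewrite IH.
Qed.

Section Stochastic.
Variable q : seq S -> S -> R.
Hypothesis q_ge0 : forall h s, 0 <= q h s.
Hypothesis q_sum1 : forall h, \sum_s q h s = 1.

Lemma expect_le k h phi psi :
  (forall w, size w = k -> phi (h ++ w) <= psi (h ++ w)) ->
  expect q k h phi <= expect q k h psi.
Proof.
elim: k h => [|k IH] h le /=; first by have := le [::] erefl; rewrite cats0.
apply: ler_sum => s _; apply: ler_wpM2l => //; apply: IH => w sw.
by rewrite cat_rcons le //= sw.
Qed.

Lemma expect_cst k h c : expect q k h (fun=> c) = c.
Proof.
elim: k h => [|k IH] h //=; under eq_bigr do rewrite IH.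
by rewrite -mulr_suml q_sum1 mul1r.
Qed.

Lemma expect_ge0 k h phi : (forall w, 0 <= phi w) -> 0 <= expect q k h phi.
Proof. by move=> phi0; rewrite -(expect_cst k h 0); exact: expect_le. Qed.

Lemma expectZ k h c phi :
  expect q k h (fun w => c * phi w) = c * expect q k h phi.
Proof.
elim: k h => [|k IH] h //=; rewrite mulr_sumr; apply: eq_bigr => s _.
by rewrite IH mulrCA.
Qed.

End Stochastic.

(** Only finite sums and products are involved. The filter is arbitrary so that it may be an
    ultrafilter, and [Phi] varies because the threshold of the excess does. *)
Lemma cvg_expect (F : set_system nat) {FF : Filter F} (Q : nat -> seq S -> S -> R)
    q (Phi : nat -> seq S -> R) phi k h :
  (forall h s, Q n h s @[n --> F] --> q h s) ->
  (forall w, Phi n w @[n --> F] --> phi w) ->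
  expect (Q n) k h (Phi n) @[n --> F] --> expect q k h phi.
Proof.
move=> cQ cPhi; elim: k h => [|k IH] h /=; first exact: cPhi.
by apply: cvg_big => [|s _]; [exact: add_continuous|apply: cvgM].
Qed.

End Expect.

(** * Integration of functions of a finite trajectory prefix *)

Section Prefix.
Context (R : realType) (M : mdp R).
Local Notation S := (state_action M).

Lemma measurable_cylinder w : measurable (cylinder w : set (traj_space M)).
Proof. by apply: sub_sigma_algebra; exists w. Qed.

(** Words are countably many, so any preimage is a countable union of cylinders, whatever [phi]
    is. *)
Lemma measurable_prefix d (V : measurableType d) (phi : seq S -> V) k :
  measurable_fun setT (fun omega : traj_space M => phi (mkseq omega k)).
Proof.
move=> mT B mB; rewrite setTI.
have -> : (fun omega : traj_space M => phi (mkseq omega k)) @^-1` B =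
  \bigcup_(w : seq S) (if `[< B (phi w) /\ size w = k >] then cylinder w else set0).
  apply/seteqP; split=> omega /=.
  - move=> Bo; exists (mkseq omega k) => //.
    by case: asboolP => [_|[]]; rewrite /cylinder /= ?size_mkseq.
  - by move=> [w _]; case: asboolP => // -[Bw <-] ->.
apply: countable_bigcupT_measurable => //.
by move=> w; case: asboolP => // _; exact: measurable_cylinder.
Qed.

Variables (beta : fdist R (state M)) (pi : policy M).
Local Notation P := (traj_prob beta pi).
Local Notation q := (step_prob beta pi).

Let word_prob_rcons h w s : word_prob q h (rcons w s) = word_prob q h w * q (h ++ w) s.
Proof.
elim: w h => [|z w IH] h /=; first by rewrite cats0 mulr1 mul1r.
by rewrite IH mulrA cat_rcons.
Qed.

Let cylinder_rcons h :
  cylinder h = \big[setU/set0]_(s <- index_enum S) cylinder (rcons h s)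
    :> set (traj_space M).
Proof.
rewrite -bigcup_seq; apply/seteqP; split=> omega /=.
  move=> oh; exists (omega (size h)) => /=; first by rewrite mem_index_enum.
  by rewrite /cylinder /= size_rcons mkseqS oh.
by move=> [s _]; rewrite /cylinder /= size_rcons mkseqS => /rcons_inj[].
Qed.

(** Induction on [k] for all [h]: a cylinder is the disjoint union of those of its one-letter
    extensions, and [word_prob_rcons] supplies the weight of the added letter. *)
Let integral_cylinder k h phi : (forall w, 0 <= phi w) ->
  (\int[P]_(omega in cylinder h) (phi (mkseq omega (size h + k)))%:E =
   (word_prob q [::] h * expect q k h phi)%:E)%E.
Proof.
move=> phi0; elim: k h => [|k IH] h.
  rewrite addn0 EFinM -traj_prob_cylinder muleC -integral_cst; last first.
    exact: measurable_cylinder.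
  by apply: eq_integral => omega; rewrite inE => ->.
rewrite cylinder_rcons ge0_integral_bigsetU //=.
- rewrite [in RHS]mulr_sumr -sumEFin; apply: eq_bigr => s _.
  by rewrite -addSnnS -(size_rcons h s) IH word_prob_rcons mulrA.
- by move=> s; exact: measurable_cylinder.
- exact: index_enum_uniq.
- move=> s t _ _ [omega []]; rewrite /cylinder /= !size_rcons => ->.
  by move=> /rcons_inj[].
- apply: measurable_funTS.
  exact: (measurable_prefix (fun w => (phi w)%:E)).
- by move=> omega _; rewrite lee_fin.
Qed.

Lemma integral_prefix k phi : (forall w, 0 <= phi w) ->
  (\int[P]_omega (phi (mkseq omega k))%:E = (expect q k [::] phi)%:E)%E.
Proof.
move=> phi0; have := integral_cylinder k [::] phi0; rewrite /= mul1r => <-.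
by congr integral; apply/seteqP; split.
Qed.

End Prefix.

(** * Absorption *)

Section Absorption.
Context (R : realType) (M : mdp R) (xM : state M) (uM : act xM).
Hypothesis act_xM : forall u : act xM, u = uM.
Hypothesis trans_xM : trans uM xM = 1.
Local Notation S := (state_action M).
Implicit Types (beta : fdist R (state M)) (pi : policy M) (h : seq S) (z : S)
  (x y : state M) (A : {set state M}).

(** As [xM] is absorbing, ending elsewhere means not yet absorbed, so the mean of [alive] is a
    survival probability. The empty word counts as alive. *)
Definition alive h : R := if h is z :: h' then (tag (last z h') != xM)%:R else 1.

Lemma alive_rcons h z : alive (rcons h z) = (tag z != xM)%:R.
Proof. by case: h => [|z' h] //=; rewrite last_rcons. Qed.

Lemma alive_ge0 h : 0 <= alive h.
Proof. by case: h. Qed.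

Lemma alive_le1 h : alive h <= 1.
Proof. by case: h => //= z h; rewrite lern1; case: eqP. Qed.

(** The action probabilities at each state sum to 1, so the policy drops out and only the transition
    from the last letter remains. *)
Lemma sum_step_prob beta pi h z (F : state M -> R) :
  \sum_z' step_prob beta pi (rcons h z) z' * F (tag z') =
  \sum_y trans (tagged z) y * F y.
Proof.
transitivity (\sum_x \sum_(u : act x)
    step_prob beta pi (rcons h z) (Tagged (@act R M) u) * F x).
  rewrite sig_big_dep /=; apply: eq_bigr; by case.
apply: eq_bigr => x _; rewrite -mulr_suml; congr (_ * _).
rewrite /step_prob /= -mulr_sumr fdist_sum1 mulr1.
by case: h => //= z' h; rewrite last_rcons.
Qed.

Lemma trans_absorbed z y : tag z = xM -> y != xM -> trans (tagged z) y = 0.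
Proof.
case: z => x u /= xE yM; subst x; rewrite (act_xM u).
have := fdist_sum1 (trans uM); rewrite (bigD1 xM) //= trans_xM => /eqP.
rewrite -subr_eq0 addrAC subrr add0r psumr_eq0 => [/allP/(_ y)|x _]; last first.
  exact: fdist_ge0.
by rewrite mem_index_enum yM => /(_ isT)/eqP.
Qed.

(** Survival decreases with time: from [xM] all later mass stays at [xM], and elsewhere the bound 1
    is enough. *)
Lemma expect_alive_rcons beta pi k h z :
  expect (step_prob beta pi) k.+1 (rcons h z) alive <=
  expect (step_prob beta pi) k (rcons h z) alive.
Proof.
elim: k h z => [|k IH] h z; last first.
  by apply: ler_sum => z' _; apply: ler_wpM2l; [exact: step_prob_ge0|exact: IH].
rewrite /= [leRHS]alive_rcons.
under eq_bigr do rewrite alive_rcons.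
rewrite (sum_step_prob beta pi h z (fun y => (y != xM)%:R)).
have [zM|zM] /= := eqVneq (tag z) xM.
  rewrite big1 // => y _; have [|yM] := eqVneq y xM; first by rewrite mulr0.
  by rewrite trans_absorbed ?mul0r.
rewrite -[leRHS](fdist_sum1 (trans (tagged z))); apply: ler_sum => y _.
by apply: ler_piMr; [exact: fdist_ge0|case: (y != xM)].
Qed.

Lemma expect_alive_absorbed beta pi k h z : tag z = xM ->
  expect (step_prob beta pi) k (rcons h z) alive = 0.
Proof.
move=> zM; apply/le_anti; rewrite expect_ge0 ?andbT; first last.
- exact: alive_ge0.
- exact: step_prob_sum1.
- exact: step_prob_ge0.
have : alive (rcons h z) = 0 by rewrite alive_rcons zM eqxx.
elim: k => [|k IH] h0; first by rewrite /= h0.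
exact: le_trans (expect_alive_rcons _ _ _ _ _) (IH h0).
Qed.

Lemma eq_path_prob (f f' : selection M) x p :
  {in x :: p, forall y, f y = f' y} -> path_prob f x p = path_prob f' x p.
Proof.
elim: p x => [|y p IH] x //= ff'.
rewrite /chain ff' ?mem_head // IH // => y' y'p.
by rewrite ff' // in_cons y'p orbT.
Qed.

Hypothesis reach : reachability xM.

(* Otherwise some selection would never enter A from outside. *)
Lemma reachable_boundary A : xM \in A -> A != [set: state M]%SET ->
  exists2 x, x \notin A &
    forall u : act x, exists2 y, y \in A & 0 < trans u y.
Proof.
move=> AM AT; apply/not_exists2P => noA.
have avoid x : exists u : act x, x \notin A -> forall y, y \in A -> trans u y = 0.
  have [xA|xA] := boolP (x \in A).
    by exists (enum_val (Ordinal (act_gt0 x))).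
  case: (noA x) => [/negP //|/existsNP[u uA]]; exists u => _ y yA.
  apply/eqP; rewrite eq_le fdist_ge0 andbT leNgt; apply/negP => uy.
  by apply: uA; exists y.
pose f : selection M := finfun (fun x => sval (cid (avoid x))).
have fA x y : x \notin A -> y \in A -> trans (f x) y = 0.
  by move=> xA yA; rewrite ffunE; case: cid => u /= /(_ xA y yA).
have stuck k x : x \notin A -> chain_iter f k x xM = 0.
  elim: k x => [|k IH] x xA /=.
    by case: eqP xA => // ->; rewrite AM.
  rewrite big1 // => y _; have [yA|yA] := boolP (y \in A).
    by rewrite /chain fA ?mul0r.
  by rewrite IH ?mulr0.
have [x xA] : exists x, x \notin A.
  by apply/existsP; rewrite -negb_forall; apply: contra AT => /forallP AT;
    apply/eqP/setP => x; rewrite AT inE.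
have xM' : x != xM by apply: contra xA => /eqP ->.
by have [k [_]] := reach f xM'; rewrite stuck // ltxx.
Qed.

(** Keeping the path inside [A] protects its probability when [f] is changed outside [A]. The
    survival bound covers every policy and every history ending at [x], so it can be applied after
    any first step. *)
Definition reach_path (f : selection M) A k x p :=
  [/\ all (mem A) p, simple_path_to_xM xM x p, 0 < path_prob f x p &
    forall beta pi h z, tag z = x ->
      expect (step_prob beta pi) k (rcons h z) alive <= 1 - path_prob f x p].

(* Adding to A a state x all of whose actions may enter A: the selected action
   minimises the best product of the probability of a transition into A and that
   of the path already built there, so this product bounds from below what any
   policy achieves from x. *)
Lemma reach_path_step A k (f : selection M) x :
  x \notin A -> (forall u : act x, exists2 y, y \in A & 0 < trans u y) ->
  (forall y, y \in A -> exists p, reach_path f A k y p) ->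
  exists f' : selection M, forall y, y \in (x |: A)%SET ->
    exists p, reach_path f' (x |: A)%SET k.+1 y p.
Proof.
move=> xA xu fA.
have /choice[pth pthP] : forall y, exists p, y \in A -> reach_path f A k y p.
  move=> y; have [yA|_] := boolP (y \in A); last by exists [::].
  by have [p ?] := fA y yA; exists p.
pose v y := path_prob f y (pth y).
have v_gt0 y : y \in A -> 0 < v y by move=> /pthP[].
(* [Y u] is the most favourable state of [A] to enter under the action [u]. *)
have /choice[Y YP] : forall u : act x, exists y, y \in A /\
    forall y', y' \in A -> trans u y' * v y' <= trans u y * v y.
  move=> u; have [y0 y0A _] := xu u.
  by case: (arg_maxP (fun y => trans u y * v y) y0A) => y yA ymax; exists y.
have YA u : Y u \in A by case: (YP u).
have g_gt0 u : 0 < trans u (Y u) * v (Y u).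
  have [y yA uy] := xu u; apply: (lt_le_trans _ ((YP u).2 y yA)).
  by rewrite mulr_gt0 ?v_gt0.
(* The selected action is the least favourable one, so the resulting bound holds for every action a
   policy may draw. *)
have [u uP] : exists u : act x, forall u',
    trans u (Y u) * v (Y u) <= trans u' (Y u') * v (Y u').
  pose u0 : act x := enum_val (Ordinal (act_gt0 x)).

  case: (@arg_minP _ _ _ u0 xpredT (fun u => trans u (Y u) * v (Y u)) isT).
  by move=> u _ um; exists u => u'; exact: um.
pose f' : selection M := finfun (eqtype.dfwith (fun y => f y) u).
have f'x : f' x = u by rewrite ffunE dfwith_in.
have f'A y : y \in A -> f' y = f y.
  by move=> yA; rewrite ffunE dfwith_out //; apply: contraNneq xA => ->.
have pathA y p : y \in A -> all (mem A) p -> path_prob f' y p = path_prob f y p.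
  move=> yA /allP pA; apply: eq_path_prob => y'; rewrite in_cons.
  by case/predU1P => [->|/pA]; apply: f'A.
exists f' => y; rewrite in_setU1; have [->{y} _|yx /= yA] := eqVneq y x; last first.
  have [pA sp p0 pP] := pthP y yA; exists (pth y).
  split; rewrite ?pathA //.
    by apply/allP => y' /(allP pA) /=; rewrite in_setU1 => ->; rewrite orbT.
  (* For the states already in [A], the additional step can only lower survival. *)
  move=> beta pi h z zy; exact: le_trans (expect_alive_rcons _ _ _ _ _) (pP _ _ _ _ zy).
have [pA /andP[up lp] p0 pP] := pthP _ (YA u).
have pE : path_prob f' x (Y u :: pth (Y u)) = trans u (Y u) * v (Y u).
  by rewrite /= pathA // /chain f'x.
exists (Y u :: pth (Y u)); split; rewrite ?pE //.
- rewrite /= in_setU1 YA orbT /=.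
  by apply/allP => y' /(allP pA) /=; rewrite in_setU1 => ->; rewrite orbT.
- rewrite /simple_path_to_xM cons_uniq up lp !andbT in_cons negb_or.
  apply/andP; split; first by apply: contraNneq xA => ->.
  by apply/negP => /(allP pA) /=; rewrite (negbTE xA).
move=> beta pi h z zx; case: z zx => x' w /= xx'; subst x'.
apply: (@le_trans _ _ (1 - trans w (Y w) * v (Y w))); last by rewrite lerD2l lerN2.
(* Condition on the next state: at [Y w] the path built there bounds survival by [1 - v (Y w)];
   elsewhere the bound is 1. *)
have -> : 1 - trans w (Y w) * v (Y w) =
    \sum_y trans w y * (1 - (y == Y w)%:R * v (Y w)).
  under eq_bigr do rewrite mulrBr mulr1.
  rewrite sumrB fdist_sum1 (bigD1 (Y w)) //= eqxx mul1r big1 ?addr0 // => y /negbTE ->.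
  by rewrite mul0r mulr0.
rewrite -(sum_step_prob beta pi h (Tagged (@act R M) w)
  (fun y => 1 - (y == Y w)%:R * v (Y w))).
apply: ler_sum => z _; rewrite ler_wpM2l ?step_prob_ge0 //.
have [zY|_] := eqVneq (tag z) (Y w).
  by rewrite mul1r; have [_ _ _] := pthP _ (YA w); apply.
rewrite mul0r subr0 -[leRHS](expect_cst (step_prob_sum1 beta pi) k
  (rcons (rcons h (Tagged (@act R M) w)) z)).
apply: expect_le; first exact: step_prob_ge0.
by move=> *; exact: alive_le1.
Qed.

(** [A] starts as the singleton of [xM] with [k = 0] and gains one state per step, so it is the
    whole space at [k = n - 1]. *)
Lemma exists_reach_paths : exists f : selection M,
  forall x, exists p, reach_path f [set: state M]%SET #|state M|.-1 x p.
Proof.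
suff H k : (k < #|state M|)%N -> exists (A : {set state M}) (f : selection M),
    [/\ xM \in A, #|A| = k.+1 &
      forall x, x \in A -> exists p, reach_path f A k x p].
  have [|A [f [_ cA fA]]] := H #|state M|.-1; first by rewrite prednK ?state_gt0.
  have AT : A = [set: state M]%SET.
    by apply/eqP; rewrite eqEcard finset.subsetT cardsT cA prednK ?state_gt0 //=.
  by exists f => x; rewrite -AT; apply: fA; rewrite AT inE.
elim: k => [|k IH] kn.
  exists [set xM]%SET, (finfun (fun x => enum_val (Ordinal (act_gt0 x)))).
  split; rewrite ?cards1 ?set11 // => x /set1P ->; exists [::]; split => //.
    by rewrite /simple_path_to_xM /= eqxx.
  by move=> beta pi h z zM; rewrite /= subrr alive_rcons zM eqxx.
have [A [f [AM cA fA]]] := IH (ltnW kn).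
have [|x xA xu] := reachable_boundary AM.
  by apply: contraTneq kn => AT; rewrite -cA AT cardsT ltnn.
have [f' f'P] := reach_path_step xA xu fA.
exists (x |: A)%SET, f'; split=> //; first by rewrite in_setU1 AM orbT.
by rewrite cardsU1 xA cA.
Qed.

Lemma gamma_gt0 : 0 < gamma xM.
Proof.
apply: lt_bigmin => // f _; apply: lt_bigmin => // x _.
by apply: lt_bigmin => // p /andP[].
Qed.

Lemma gamma_le1 : gamma xM <= 1.
Proof. exact: bigmin_le_id. Qed.

(** A simple path repeats no vertex, hence obeys the length bound of the sequences in
    [min_path_prob]. *)
Lemma gamma_le_path_prob (f : selection M) x p : x != xM ->
  simple_path_to_xM xM x p -> 0 < path_prob f x p -> gamma xM <= path_prob f x p.
Proof.
move=> xM' sp p0.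
have size_p : (size p <= #|state M|)%N.
  case/andP: sp => /card_uniqP /= up _.
  by rewrite (leq_trans _ (max_card (mem (x :: p)))) // up.
apply: (@le_trans _ _ (\big[Order.min/1]_(x | x != xM) min_path_prob xM f x)).
  exact: bigmin_le.
apply: (@le_trans _ _ (min_path_prob xM f x)); first exact: bigmin_le_cond.
by apply: (bigmin_le_cond _ (j := Bseq size_p)) => /=; rewrite sp.
Qed.

Local Notation n := #|state M|.

Lemma expect_alive_block beta pi h z :
  expect (step_prob beta pi) n (rcons h z) alive <=
  (1 - gamma xM) * alive (rcons h z).
Proof.
have [zM|zM] := eqVneq (tag z) xM.
  by rewrite expect_alive_absorbed // alive_rcons zM eqxx mulr0.
rewrite alive_rcons zM mulr1.
have [f fP] := exists_reach_paths; have [p [_ sp p0 pP]] := fP (tag z).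
(* The paths bound survival after [n - 1] steps; monotonicity carries the bound to step [n]. *)
rewrite -(prednK (state_gt0 M)) (le_trans (expect_alive_rcons _ _ _ _ _)) //.
by rewrite (le_trans (pP _ _ _ _ erefl)) // lerD2l lerN2 gamma_le_path_prob.
Qed.

(** The one-block bound holds after every history, so it can be iterated although the policy
    remembers the past. *)
Lemma expect_alive_blocks beta pi j h z :
  expect (step_prob beta pi) (n * j) (rcons h z) alive <= (1 - gamma xM) ^+ j.
Proof.
elim: j => [|j IH]; first by rewrite muln0 /= expr0 alive_le1.
rewrite mulnSr expectD exprS.
apply: (@le_trans _ _ (expect (step_prob beta pi) (n * j) (rcons h z)
    (fun w => (1 - gamma xM) * alive w))); last first.
  by rewrite expectZ ler_wpM2l // subr_ge0 gamma_le1.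
apply: expect_le => [|w _]; first exact: step_prob_ge0.
by case/lastP: w => [|w z']; rewrite ?cats0 -?rcons_cat expect_alive_block.
Qed.

(** A word of [t.+1] letters ends at time [t]. Its first letter draws the initial state; the other
    [t] letters are [t %% n] letters followed by [t %/ n] full blocks. *)
Lemma expect_alive_le beta pi t :
  expect (step_prob beta pi) t.+1 [::] alive <= (1 - gamma xM) ^+ (t %/ n).
Proof.
rewrite /= -[leRHS]mul1r -[X in _ <= X * _](step_prob_sum1 beta pi [::]) mulr_suml.
apply: ler_sum => z _; rewrite ler_wpM2l ?step_prob_ge0 //.
rewrite {1}(divn_eq t n) addnC mulnC expectD.
rewrite -[leRHS](expect_cst (step_prob_sum1 beta pi) (t %% n) (rcons [::] z)).
apply: expect_le => [|w _]; first exact: step_prob_ge0.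
case/lastP: w => [|w z']; first exact: (expect_alive_blocks _ _ _ [::] z).
by rewrite -rcons_cat; exact: expect_alive_blocks.
Qed.

End Absorption.

(** * Tail costs *)

(* The summand is the decrement of the potential t |-> (n - t %% n) a^(t %/ n) +
   n a^(t %/ n + 1) / (1 - a). *)
Lemma sum_expr_div_le (R : realFieldType) (a : R) (n k N : nat) :
  0 <= a < 1 -> (0 < n)%N ->
  \sum_(0 <= i < N) a ^+ ((i + k) %/ n) <= n%:R * (a ^+ (k %/ n) / (1 - a)).
Proof.
move=> /andP[a0 a1] n0.
pose Phi t := (n%:R - (t %% n)%:R) * a ^+ (t %/ n) + n%:R * a ^+ (t %/ n).+1 / (1 - a).
have a1' : 1 - a != 0 by rewrite subr_eq0 gt_eqF.
have step t : a ^+ (t %/ n) = Phi t - Phi t.+1.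
  rewrite /Phi modnS divnS //; case: ifPn => [dt|_]; last first.
    by rewrite add0n -natr1; ring.
  (* Here [n] divides [t.+1], so [t %% n] is [n - 1]. *)
  have -> : n%:R = (t %% n)%:R + 1 :> R.
    rewrite natr1; congr _%:R; apply/eqP; rewrite eqn_leq ltn_mod n0 andbT.
    by rewrite dvdn_leq // -(dvdn_addr _ (dvdn_mull (t %/ n) (dvdnn n))) addnS -divn_eq.
  by rewrite add1n !exprS; field.
have Phi_ge0 t : 0 <= Phi t.
  apply: addr_ge0; first by rewrite mulr_ge0 ?exprn_ge0 // subr_ge0 ler_nat ltnW ?ltn_mod.
  by rewrite !mulr_ge0 ?invr_ge0 ?exprn_ge0 // subr_ge0 ltW.
apply: (@le_trans _ _ (Phi k)).
  have -> : \sum_(0 <= i < N) a ^+ ((i + k) %/ n) = Phi k - Phi (N + k)%N.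
    elim: N => [|N IH]; first by rewrite big_geq // subrr.
    by rewrite big_nat_recr //= IH step addrA subrK.
  by rewrite gerBl.
(* After discarding [k %% n], with [q = k %/ n], the sum of [n a^q] and [n a^(q+1) / (1 - a)] is
   [n a^q / (1 - a)]. *)
rewrite /Phi; apply: (@le_trans _ _
  (n%:R * a ^+ (k %/ n) + n%:R * a ^+ (k %/ n).+1 / (1 - a))).
  by rewrite lerD2r ler_wpM2r ?exprn_ge0 // gerBl.
by rewrite exprS le_eqVlt; apply/orP; left; apply/eqP; field.
Qed.

Section Costs.
Context (R : realType) (M : mdp R).
Local Notation S := (state_action M).

Definition last_cost (h : seq S) : R :=
  if h is z :: h' then cost (tagged (last z h')) else 0.

Definition prefix_cost (h : seq S) : R := \sum_(z <- h) cost (tagged z).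

Definition tail_cost k (omega : traj_space M) : \bar R :=
  (\sum_(0 <= i <oo) (cost_at omega (i + k))%:E)%E.

Lemma last_cost_ge0 h : 0 <= last_cost h.
Proof. by case: h => // z h; exact: cost_ge0. Qed.

Lemma prefix_cost_ge0 h : 0 <= prefix_cost h.
Proof. by apply: sumr_ge0 => z _; exact: cost_ge0. Qed.

Lemma tail_cost_ge0 k omega : (0 <= tail_cost k omega)%E.
Proof. by apply: nneseries_ge0 => i _ _; rewrite lee_fin cost_ge0. Qed.

Lemma cost_atE omega t : cost_at omega t = last_cost (mkseq omega t.+1).
Proof.
rewrite mkseqS /last_cost /cost_at; case: (mkseq omega t) => [|z h] //=.
by rewrite last_rcons.
Qed.

Lemma prefix_costE omega k :
  prefix_cost (mkseq omega k) = \sum_(0 <= t < k) cost_at omega t.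
Proof. by rewrite /prefix_cost big_map /index_iota subn0. Qed.

Lemma total_cost_split k omega :
  total_cost omega = ((prefix_cost (mkseq omega k))%:E + tail_cost k omega)%E.
Proof.
have c0 t : (0 <= (cost_at omega t)%:E)%E by rewrite lee_fin cost_ge0.
rewrite /total_cost (nneseries_split _ k) // add0n prefix_costE -sumEFin.
by rewrite -(nneseries_addn k).
Qed.

Lemma measurable_cost_at t :
  measurable_fun setT (fun omega : traj_space M => (cost_at omega t)%:E).
Proof.
rewrite [X in measurable_fun _ X](_ : _ = fun omega : traj_space M =>
  (last_cost (mkseq omega t.+1))%:E); last by apply/funext => w; rewrite cost_atE.
exact: (measurable_prefix (fun w => (last_cost w)%:E)).
Qed.

Lemma measurable_tail_cost k : measurable_fun setT (tail_cost k).
Proof.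
apply: ge0_emeasurable_sum => [i omega _ _|i _]; last exact: measurable_cost_at.
by rewrite lee_fin cost_ge0.
Qed.

Variables (xM : state M) (uM : act xM).
Hypothesis act_xM : forall u : act xM, u = uM.
Hypothesis cost_xM : cost uM = 0.

(** At [xM] the only action is free; elsewhere [Kmax] bounds the cost. *)
Lemma last_cost_le h : h != [::] -> last_cost h <= Kmax xM * alive xM h.
Proof.
case: h => //= z h _; have [|zM] := eqVneq (tag (last z h)) xM; last first.
  by rewrite mulr1; apply: (le_bigmax_cond _ (fun z : S => cost (tagged z))).
case: (last z h) => x u /= xE; subst x.
by rewrite (act_xM u) cost_xM mulr0.
Qed.

Lemma Kmax_ge0 : 0 <= Kmax xM.
Proof. exact: bigmax_ge_id. Qed.

(** Times [0] to [k] are paid, hence [k.+1] letters; afterwards only the free action [uM] is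
    used. *)
Lemma surrogate_costE k omega :
  surrogate_cost uM k omega = (prefix_cost (mkseq omega k.+1))%:E.
Proof.
have c0 t : (0 <= (cost_at (surrogate uM k omega) t)%:E)%E by rewrite lee_fin cost_ge0.
rewrite /surrogate_cost /total_cost (nneseries_split _ k.+1) // add0n.
rewrite eseries0 ?adde0; last first.
  by move=> i ki _; rewrite /cost_at /surrogate leqNgt ki /= cost_xM.
rewrite sumEFin prefix_costE; congr EFin; apply: eq_big_nat => t /andP[_ tk].
by rewrite /cost_at /surrogate -ltnS tk.
Qed.

Hypothesis trans_xM : trans uM xM = 1.
Hypothesis reach : reachability xM.
Variables (beta : fdist R (state M)) (pi : policy M).

(** The cost at time [i + k] has mean at most [Kmax] times the survival bound of [expect_alive_le];
    these bounds are summed by [sum_expr_div_le] with [a = 1 - gamma]. *)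
Lemma mean_tail_cost k :
  (\int[traj_prob beta pi]_omega tail_cost k omega <=
   (#|state M|%:R * Kmax xM *
     ((1 - gamma xM) ^+ (k %/ #|state M|) / gamma xM))%:E)%E.
Proof.
rewrite integral_nneseries //; last 2 first.
- by move=> i; exact: measurable_cost_at.
- by move=> i omega _; rewrite lee_fin cost_ge0.
apply: lime_le.
  apply: is_cvg_nneseries => i _ _; apply: integral_ge0 => omega _.
  by rewrite lee_fin cost_ge0.
apply: nearW => N /=.
apply: (@le_trans _ _ (\sum_(0 <= i < N)
  (Kmax xM * (1 - gamma xM) ^+ ((i + k) %/ #|state M|))%:E)%E).
  apply: lee_sum => i _.
  rewrite (eq_integral (fun omega : traj_space M =>
    (last_cost (mkseq omega (i + k).+1))%:E)); last by move=> w _; rewrite cost_atE.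
  rewrite integral_prefix ?lee_fin; last exact: last_cost_ge0.
  apply: (@le_trans _ _ (expect (step_prob beta pi) (i + k).+1 [::]
      (fun w => Kmax xM * alive xM w))).
    apply: expect_le => [|w sw]; first exact: step_prob_ge0.
    by rewrite cat0s last_cost_le // -size_eq0 sw.
  by rewrite expectZ ler_wpM2l ?Kmax_ge0 // (expect_alive_le act_xM).
rewrite sumEFin lee_fin -mulr_sumr mulrC [_ * Kmax _]mulrC -mulrA [leLHS]mulrC.
rewrite ler_wpM2l ?Kmax_ge0 //.
have {3}-> : gamma xM = 1 - (1 - gamma xM) by rewrite subKr.
apply: sum_expr_div_le; last exact: state_gt0.
by rewrite subr_ge0 gamma_le1 ltrBlDr ltrDl gamma_gt0.
Qed.

End Costs.

(** * Existence of an optimal policy *)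

(** Compactness gives a cluster point. If the preimage of a neighbourhood were not in [U], that of
    its complement would be, contradicting clustering. *)
Lemma ultra_cvg_segment (R : realType) (T : Type) (U : set_system T) (a b : R)
    (u : T -> R) : UltraFilter U -> (forall j, a <= u j <= b) ->
  exists2 l, a <= l <= b & u j @[j --> U] --> l.
Proof.
move=> UU uab.
have UP : ProperFilter (fmap u U) by exact: fmap_proper_filter.
have [|l [lab lu]] := @segment_compact R a b (fmap u U) UP.
  by apply: (@filterE _ U _ (u @^-1` _)) => j /=; rewrite in_itv /= uab.
exists l; first by move: lab; rewrite /= in_itv.
move=> N lN; have [//|UN] := in_ultra_setVsetC (u @^-1` N) UU.
by have [x []] := lu (~` N) N UN lN.
Qed.

Section PolicyLimit.
Context (R : realType) (M : mdp R) (U : set_system nat) (UU : UltraFilter U).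

(** One ultrafilter makes all coordinates converge at once, with no diagonal extraction. Action sets
    are finite, so total mass 1 passes to the limit. *)
Lemma policy_limit (pi : nat -> policy M) :
  exists pi' : policy M, forall h x u, pi j h x u @[j --> U] --> pi' h x u.
Proof.
have /choice[l lP] : forall hxu : {hx : seq (state_action M) * state M & act hx.2},
    exists l : R, 0 <= l <= 1 /\
      pi j (tag hxu).1 (tag hxu).2 (tagged hxu) @[j --> U] --> l.
  move=> [[h x] u] /=.
  have [|l l01 cl] := @ultra_cvg_segment R nat U 0 1 (fun j => pi j h x u) UU.
    move=> j; rewrite fdist_ge0 -(fdist_sum1 (pi j h x)) (bigD1 u) //= lerDl.
    by apply: sumr_ge0 => *; exact: fdist_ge0.
  by exists l.
pose p h x u := l (existT (fun hx : seq (state_action M) * state M => act hx.2) (h, x) u).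
have p_cvg h x u : pi j h x u @[j --> U] --> p h x u.
  by have [_] := lP (existT _ (h, x) u).
have p_ge0 h x u : 0 <= p h x u by have [/andP[]] := lP (existT _ (h, x) u).
have p_sum1 h x : \sum_u p h x u = 1.
  have c1 : \sum_u pi j h x u @[j --> U] --> \sum_u p h x u.
    by apply: cvg_big => [|u _]; [exact: add_continuous|exact: p_cvg].
  have c2 : \sum_u pi j h x u @[j --> U] --> (1 : R).
    rewrite [X in X @ U](_ : _ = fun=> 1); first exact: cvg_cst.
    by apply/funext => j; rewrite fdist_sum1.
  exact: (cvg_unique _ c1 c2).
by exists (fun h x => FDist (p_ge0 h x) (p_sum1 h x)).
Qed.

End PolicyLimit.

Lemma exists_policy (R : realType) (M : mdp R) : exists pi : policy M, True.
Proof.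
have d (x : state M) : exists p : fdist R (act x), True.
  pose u0 : act x := enum_val (Ordinal (act_gt0 x)).
  have p_ge0 u : 0 <= (u == u0)%:R :> R by [].
  have p_sum1 : \sum_u (u == u0)%:R = 1 :> R.
    by rewrite (bigD1 u0) //= eqxx big1 ?addr0 // => u /negbTE ->.
  by exists (FDist p_ge0 p_sum1).
by exists (fun _ x => sval (cid (d x))).
Qed.

Section Minimum.
Context (R : realType) (M : mdp R) (beta : fdist R (state M)) (tau : R).
Local Notation S := (state_action M).
Variable Y : traj_space M -> \bar R.
Hypothesis mY : measurable_fun setT Y.
Hypothesis Y0 : forall omega, (0 <= Y omega)%E.
Hypothesis tau01 : 0 < tau < 1.
Variable B : R.
Hypothesis B0 : 0 < B.
Hypothesis YB : forall pi, (\int[traj_prob beta pi]_omega Y omega <= B%:E)%E.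

Let tau1 : 0 < 1 - tau. Proof. by rewrite subr_gt0; case/andP: tau01. Qed.

Let risk pi := AVaR (traj_prob beta pi) Y tau.

Let attained pi : exists2 s, 0 <= s <= B / (1 - tau) &
  risk pi = (s%:E + ((1 - tau)^-1)%:E *
    \int[traj_prob beta pi]_omega maxe (Y omega - s%:E) 0)%E.
Proof. exact: AVaR_attained. Qed.

(** Coordinatewise convergence of policies controls only functions of finite prefixes, so the
    remainder [Z] must be small in mean uniformly in [pi]. *)
Hypothesis approx : forall e : R, 0 < e -> exists k (phi : seq S -> R)
    (Z : traj_space M -> \bar R),
  [/\ forall w, 0 <= phi w, measurable_fun setT Z, forall omega, (0 <= Z omega)%E,
    forall omega, Y omega = ((phi (mkseq omega k))%:E + Z omega)%E &
    forall pi, (\int[traj_prob beta pi]_omega Z omega <= e%:E)%E].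

Let risk_ge0 pi : (0 <= risk pi)%E.
Proof.
have [s /andP[s0 _] ->] := attained pi; apply: adde_ge0; first by rewrite lee_fin.
apply: mule_ge0; first by rewrite lee_fin invr_ge0 ltW.
by apply: integral_ge0 => w _; rewrite le_max lexx orbT.
Qed.

Let risk_lty pi : (risk pi < +oo)%E.
Proof.
apply: (le_lt_trans (AVaR_le_excess (traj_prob beta pi) mY Y0 tau01 (lexx 0))).
rewrite add0e; under eq_integral do rewrite sube0 max_l //.
apply: lte_mul_pinfty; rewrite ?lee_fin ?invr_ge0 ?(ltW tau1) //.
exact: le_lt_trans (YB pi) (ltry _).
Qed.

(** The limit of the optimal thresholds of a minimising sequence is a trial value for the limit
    policy, whose risk is thereby at most the infimum. *)
Lemma exists_min_AVaR : exists pi0, forall pi, (risk pi0 <= risk pi)%E.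
Proof.
pose v := ereal_inf (range risk).
have [pi00 _] := exists_policy M.
have vfin : v \is a fin_num.
  rewrite fin_real //; apply/andP; split.
    apply: (@lt_le_trans _ _ 0%E); first exact: ltNyr.
    by apply: le_ereal_inf_tmp => _ [pi _ <-].
  by apply: le_lt_trans (risk_lty pi00); apply: ereal_inf_lbound; exists pi00.
suff [pi0 pi0v] : exists pi0, (risk pi0 <= v)%E.
  by exists pi0 => pi; apply: (le_trans pi0v); apply: ereal_inf_lbound; exists pi.
have /choice[p pP] : forall j, exists pi, (risk pi < v + (j.+1%:R^-1)%:E)%E.
  move=> j; have [|_ [pi _ <-] h] :=
    @lb_ereal_inf_adherent _ (range risk) j.+1%:R^-1 _ vfin.
    by rewrite invr_gt0.
  by exists pi.
have /choice[s sP] : forall j, exists s : R, 0 <= s <= B / (1 - tau) /\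
  risk (p j) = (s%:E + ((1 - tau)^-1)%:E *
    \int[traj_prob beta (p j)]_omega maxe (Y omega - s%:E) 0)%E.
  by move=> j; have [s] := attained (p j); exists s.
(* [U] refines the eventual filter, so [j.+1%:R^-1] still tends to 0 along it. *)
have [U [UU FU]] := ultraFilterLemma eventually_filter.
have [s' /andP[s'0 _] s_cvg] := ultra_cvg_segment UU (fun j => (sP j).1).
have [p' p_cvg] := policy_limit UU p.
exists p'; apply/lee_addgt0Pr => e e0.
(* A remainder of mean [e * (1 - tau)] contributes [e] after division by [1 - tau]. The policy [p']
   was fixed before [e]. *)
have e1 : 0 < e * (1 - tau) by rewrite mulr_gt0.
have [k [phi [Z [phi0 mZ Z0 YE ZE]]]] := approx e1.
pose X (pi : policy M) t :=
  expect (step_prob beta pi) k [::] (fun w => Num.max (phi w - t) 0).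
have max0 t w : 0 <= Num.max (phi w - t) 0 by rewrite le_max lexx orbT.
have mphi t : measurable_fun setT
    (fun omega : traj_space M => (Num.max (phi (mkseq omega k) - t) 0)%:E).
  exact: (measurable_prefix (fun w => (Num.max (phi w - t) 0)%:E)).
have X_le pi t : ((X pi t)%:E <= \int[traj_prob beta pi]_omega maxe (Y omega - t%:E) 0)%E.
  rewrite -integral_prefix //; apply: ge0_le_integral => //.
    by move=> w _; rewrite lee_fin.
    by apply: measurable_maxe => //; exact: emeasurable_funB.
  move=> w _; rewrite YE EFin_max ge_max; apply/andP; split.
    by rewrite le_max EFinB leeD2r ?leeDl.
  by rewrite le_max lexx orbT.
have le_X pi t : (\int[traj_prob beta pi]_omega maxe (Y omega - t%:E) 0 <=
    (X pi t + e * (1 - tau))%:E)%E.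
  under eq_integral do rewrite YE.
  have XE : (X pi t)%:E =
      (\int[traj_prob beta pi]_omega maxe ((phi (mkseq omega k))%:E - t%:E) 0)%E.
    by rewrite -integral_prefix //; apply: eq_integral => w _; rewrite EFin_max.
  rewrite EFinD XE.
  apply: (le_trans (integral_excessD_le _ _ _ _ _)) => //.
    exact: (measurable_prefix (fun w => (phi w)%:E)).
  by rewrite leeD2l ?ZE.
have X_cvg : X (p j) (s j) @[j --> U] --> X p' s'.
  apply: cvg_expect => [h z|w].
    by apply: cvgM; [exact: cvg_cst|exact: p_cvg].
  have c : {for s', continuous ((fun t : R => phi w - t : R^o) \max (fun=> 0))}.
    apply: continuous_max; last exact: cst_continuous.
    by apply: continuousB; [exact: cst_continuous|exact: cvg_id].
  exact: (cvg_comp _ _ s_cvg c).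
(* The lower bound [X_le] is used along the sequence, and the upper bound [le_X] only at the limit
   policy. *)
have le_v : s' + (1 - tau)^-1 * X p' s' <= fine v.
  have c1 : s j + (1 - tau)^-1 * X (p j) (s j) @[j --> U] --> s' + (1 - tau)^-1 * X p' s'.
    by apply: cvgD => //; apply: cvgM => //; exact: cvg_cst.
  have c2 : fine v + j.+1%:R^-1 @[j --> U] --> fine v + 0.
    apply: cvgD; first exact: cvg_cst.
    by apply: cvg_trans (@cvg_harmonic R); exact: cvg_app.
  rewrite -[leRHS]addr0; apply: (ler_cvg_to c1 c2); apply: nearW => j.
  rewrite -lee_fin EFinD [leRHS]EFinD fineK // EFinM; apply: le_trans (ltW (pP j)).
  rewrite (sP j).2 leeD2l // lee_wpmul2l ?lee_fin ?invr_ge0 ?(ltW tau1) //.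
apply: (le_trans (AVaR_le_excess _ mY Y0 tau01 s'0)).
apply: (@le_trans _ _ (s'%:E + ((1 - tau)^-1)%:E * (X p' s' + e * (1 - tau))%:E)%E).
  by rewrite leeD2l // lee_wpmul2l ?lee_fin ?invr_ge0 ?(ltW tau1).
rewrite -[v]fineK // -EFinM -!EFinD lee_fin mulrDr addrA.
by rewrite lerD // mulrC mulfK // gt_eqF.
Qed.

End Minimum.

(** * Comparison of the original and surrogate problems *)

Lemma exists_expr_le (R : realType) (a C e : R) : 0 <= a < 1 -> 0 < e ->
  exists j : nat, C * a ^+ j <= e.
Proof.
move=> /andP[a0 a1] e0.
have c : C * a ^+ j @[j --> \oo] --> C * 0.
  by apply: cvgM; [exact: cvg_cst|apply: cvg_expr; rewrite ger0_norm].
rewrite mulr0 in c.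
have [N _ /(_ N (leqnn N)) /= h] := cvgr_le _ c _ e0.
by exists N.
Qed.

Theorem theorem3 (R : realType) (M : mdp R) (xM : state M) (uM : act xM)
    (beta : fdist R (state M)) (tau : R) (d : nat)
    (hM : transient_total_cost uM beta)
    (hbeta : beta xM = 0)
    (hpos : 0 < Kmin xM)
    (hreach : reachability xM)
    (htau : 0 < tau < 1) :
  let n := #|state M| in
  exists m_d m : \bar R,
    [/\ is_min (fun pi : policy M =>
          AVaR (traj_prob beta pi) (surrogate_cost uM d) tau) m_d,
        is_min (fun pi : policy M =>
          AVaR (traj_prob beta pi) (@total_cost R M) tau) m,
        (m_d <= m)%E &
        (m <= m_d + (n%:R * Kmax xM / (1 - tau) *
               ((1 - gamma xM) ^+ (d.+1 %/ n) / gamma xM))%:E)%E].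
Proof.
move=> n; case: hM => act_xM trans_xM cost_xM _.
have a01 : 0 <= 1 - gamma xM < 1.
  by rewrite subr_ge0 gamma_le1 ltrBlDr ltrDl gamma_gt0.
(* [C k] bounds the mean cost from time [k] on: [C 0] controls the mean total cost and [C d.+1]
   gives the error term. *)
pose C k : R := n%:R * Kmax xM * ((1 - gamma xM) ^+ (k %/ n) / gamma xM).
have C0 k : 0 <= C k.
  rewrite !mulr_ge0 ?invr_ge0 ?Kmax_ge0 ?exprn_ge0 ?(ltW (gamma_gt0 _)) //.
  by case/andP: a01.
have tailC k pi : (\int[traj_prob beta pi]_w tail_cost k w <= (C k)%:E)%E.
  exact: (mean_tail_cost act_xM cost_xM trans_xM hreach).
pose Y := @total_cost R M : traj_space M -> \bar R.
pose Yd := surrogate_cost uM d : traj_space M -> \bar R.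
have YE : Y = tail_cost 0.
  by apply/funext => w; rewrite /Y (total_cost_split 0) /prefix_cost big_nil add0e.
have YdE w : Yd w = (prefix_cost (mkseq w d.+1))%:E by exact: surrogate_costE.
have YdD : Y = (fun w => Yd w + tail_cost d.+1 w)%E.
  by apply/funext => w; rewrite YdE /Y (total_cost_split d.+1).
have mY : measurable_fun setT Y by rewrite YE; exact: measurable_tail_cost.
have mYd : measurable_fun setT Yd.
  rewrite (_ : Yd = fun w => (prefix_cost (mkseq w d.+1))%:E); last exact/funext.
  exact: (measurable_prefix (fun w => (prefix_cost w)%:E)).
have Y0 w : (0 <= Y w)%E by rewrite YE tail_cost_ge0.
have Yd0 w : (0 <= Yd w)%E by rewrite YdE lee_fin prefix_cost_ge0.
have YdY w : (Yd w <= Y w)%E by rewrite YdD leeDl // tail_cost_ge0.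
have B0 : 0 < C 0 + 1 by rewrite ltr_wpDl.
have YB pi : (\int[traj_prob beta pi]_w Y w <= (C 0 + 1)%:E)%E.
  by rewrite YE (le_trans (tailC 0 pi)) // lee_fin lerDl.
have YdB pi : (\int[traj_prob beta pi]_w Yd w <= (C 0 + 1)%:E)%E.
  by apply: le_trans (YB pi); apply: ge0_le_integral.
have [pd pdP] : exists pd, forall pi,
    (AVaR (traj_prob beta pd) Yd tau <= AVaR (traj_prob beta pi) Yd tau)%E.
  apply: (exists_min_AVaR mYd Yd0 htau B0 YdB) => e e0.
  (* The surrogate cost is a function of [d.+1] letters, so the remainder is zero. *)
  exists d.+1, (@prefix_cost R M), (fun=> 0%E); split=> //.
  - exact: prefix_cost_ge0.
  - by move=> w; rewrite adde0.
  - by move=> pi; rewrite integral0 lee_fin ltW.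
have [p pP] : exists p, forall pi,
    (AVaR (traj_prob beta p) Y tau <= AVaR (traj_prob beta pi) Y tau)%E.
  apply: (exists_min_AVaR mY Y0 htau B0 YB) => e e0.
  have [j jP] := exists_expr_le (n%:R * Kmax xM / gamma xM) a01 e0.
  (* A multiple of [n] makes the exponent in [C] exactly [j]. *)
  exists (j * n)%N, (@prefix_cost R M), (tail_cost (j * n)); split.
  - exact: prefix_cost_ge0.
  - exact: measurable_tail_cost.
  - exact: tail_cost_ge0.
  - by move=> w; exact: total_cost_split.
  move=> pi; apply: (le_trans (tailC _ pi)); rewrite lee_fin.
  apply: le_trans jP; rewrite /C mulnK ?state_gt0 //.
  by rewrite (mulrC _ (gamma xM)^-1) !mulrA.
exists (AVaR (traj_prob beta pd) Yd tau), (AVaR (traj_prob beta p) Y tau).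
split.
- by split; [exists pd; exact: erefl|exact: pdP].
- by split; [exists p; exact: erefl|exact: pP].
(* The optimal policy of the original problem is tried in the surrogate problem, whose cost is
   smaller along each trajectory. *)
- by apply: (le_trans (pdP p)); exact: le_AVaR.
(* Conversely, [pd] is tried in the original problem, where it incurs in addition the cost from time
   [d.+1] on. *)
apply: (le_trans (pP pd)); rewrite YdD.
apply: (le_trans (AVaRD_le mYd (measurable_tail_cost _) Yd0 (tail_cost_ge0 _)
  htau B0 (YdB pd))).
rewrite leeD2l //.
apply: (@le_trans _ _ (((1 - tau)^-1)%:E * (C d.+1)%:E)%E).
  by rewrite lee_wpmul2l // lee_fin invr_ge0 subr_ge0 ltW //; case/andP: htau.
by rewrite -EFinM lee_fin /C mulrA (mulrC (1 - tau)^-1).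
Qed.
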